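(* Let $G$ be a group which admits a limiting sequence pair. Then $G$ is n-slender, cm-slender and lcH-slender.
   Context: Throughout, $\mathbb{N}=\{1,2,3,\dots\}$. For a subset $S$ of a group $G$ and $j\in\mathbb{N}$, the $j$-th radical of $S$ is $\sqrt[j]{S}=\{g\in G\mid g^j\in S\}$. A limiting sequence pair for $G$ is a pair consisting of a sequence of subsets $F_1\subseteq F_2\subseteq\cdots$ of $G$ and a sequence $k_1,k_2,\dots$ of natural numbers such that for every $n\in\mathbb{N}$: (1) for every $g\in G$ there is $m\in\mathbb{N}$ with $gF_n\subseteq F_m$; (2) $\sqrt[k_n]{F_n}=\{1_G\}$; (3) $\sqrt[k_m]{F_n}\subseteq F_n$ for all $m\le n$. Let $E=\bigcup_{n\in\mathbb{N}}C((0,\tfrac1n),\tfrac1n)\subseteq\mathbb{R}^2$ be the Hawaiian earring ($C(q,r)$ the circle of center $q$, radius $r$), and $\mathbb{H}=\pi_1(E,(0,0))$. For $N\in\mathbb{N}$ let $p_N:\mathbb{H}\to\mathbb{H}$ be the homomorphism induced by the retraction of $E$ onto the union of the first $N$ circles which collapses all other circles to the base point (so $p_N$ is a retraction onto a free subgroup of rank $N$). A group $G$ is n-slender if for every homomorphism $\phi:\mathbb{H}\to G$ there is $N\in\mathbb{N}$ with $\phi=\phi\circ p_N$. A group $G$ is cm-slender if every homomorphism from a completely metrizable topological group to $G$ has open kernel. A group $G$ is lcH-slender if every homomorphism from a locally compact Hausdorff topological group to $G$ has open kernel. *)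

(* Defs.v *)
From HB Require Import structures.
From mathcomp Require Import all_boot all_order all_algebra.
From mathcomp Require Import all_classical all_reals all_analysis.
From mathcomp Require Import Rstruct Rstruct_topology.
Set Implicit Arguments. Unset Strict Implicit. Unset Printing Implicit Defensive.
Import Order.TTheory GRing.Theory Num.Theory.
Local Open Scope classical_set_scope.
Local Open Scope ring_scope.

Notation RR := Rdefinitions.R.

Record group_on (T : Type) := GroupOn {
  gmul : T -> T -> T;
  ginv : T -> T;
  gone : T;
  gmulA : forall x y z, gmul x (gmul y z) = gmul (gmul x y) z;
  gmul1 : forall x, gmul gone x = x;
  gmulV : forall x, gmul (ginv x) x = gone
}.

Definition gpow {T} (G : group_on T) (g : T) (j : nat) : T :=
  iter j (gmul G g) (gone G).

Definition radical {T} (G : group_on T) (j : nat) (S : set T) : set T :=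
  [set g | S (gpow G g j)].

Definition is_hom {T U} (G : group_on T) (H : group_on U) (f : T -> U) :=
  forall x y, f (gmul G x y) = gmul H (f x) (f y).

(* Limiting sequence pair.  Indices are shifted: n : nat stands for the
   natural number n+1 of the paper; k n >= 1 since k_n is in N={1,2,...}. *)
Definition limiting_sequence_pair {T} (G : group_on T)
    (F : nat -> set T) (k : nat -> nat) : Prop :=
  (forall n, F n `<=` F n.+1) /\
  (forall n, (0 < k n)%N) /\
  (forall n, forall g : T, exists m : nat, [set gmul G g x | x in F n] `<=` F m) /\
  (forall n, radical G (k n) (F n) = [set gone G]) /\
  (forall n m, (m <= n)%N -> radical G (k m) (F n) `<=` F n).

Definition admits_limiting_sequence_pair {T} (G : group_on T) : Prop :=
  exists F k, limiting_sequence_pair G F k.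

Definition pt := (RR * RR)%type.
Definition base : pt := (0, 0).

Definition circle (n : nat) : set pt :=
  [set p | p.1 ^+ 2 + (p.2 - (n.+1%:R)^-1) ^+ 2 = (n.+1%:R)^-1 ^+ 2].

Definition earring : set pt := \bigcup_n circle n.

Definition unit_interval : set RR := [set s | 0 <= s <= 1].
Definition unit_square : set (RR * RR) :=
  [set q | 0 <= q.1 <= 1 /\ 0 <= q.2 <= 1].

(* based loops in E, parametrized by [0,1] (values outside [0,1] irrelevant) *)
Definition loop (g : RR -> pt) : Prop :=
  {within unit_interval, continuous g} /\
  (forall s, unit_interval s -> earring (g s)) /\
  g 0 = base /\ g 1 = base.

Definition homotopic (g h : RR -> pt) : Prop :=
  exists Hm : RR * RR -> pt,
    {within unit_square, continuous Hm} /\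
    (forall q, unit_square q -> earring (Hm q)) /\
    (forall s, unit_interval s -> Hm (s, 0) = g s) /\
    (forall s, unit_interval s -> Hm (s, 1) = h s) /\
    (forall t, unit_interval t -> Hm (0, t) = base /\ Hm (1, t) = base).

Definition concat (g h : RR -> pt) : RR -> pt :=
  fun s => if s <= 2^-1 then g (2 * s) else h (2 * s - 1).

(* A homomorphism H = pi_1(E,(0,0)) -> G, presented (via the universal
   property of the quotient) as a map on loops that is constant on
   homotopy classes and sends concatenation to the product. *)
Definition hom_from_H {T} (G : group_on T) (phi : (RR -> pt) -> T) : Prop :=
  (forall g h, loop g -> loop h -> homotopic g h -> phi g = phi h) /\
  (forall g h, loop g -> loop h -> phi (concat g h) = gmul G (phi g) (phi h)).

Definition retractN (N : nat) (p : pt) : pt :=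
  if `[< exists2 n : nat, (n < N)%N & circle n p >] then p else base.

(* phi = phi o p_N, where p_N [g] = [retractN N o g] *)
Definition n_slender {T} (G : group_on T) : Prop :=
  forall phi, hom_from_H G phi ->
    exists N : nat, (0 < N)%N /\
      forall g, loop g -> phi g = phi (retractN N \o g).

Definition topological_group {X : topologicalType} (G : group_on X) : Prop :=
  continuous (fun q : X * X => gmul G q.1 q.2) /\ continuous (ginv G).

Definition completely_metrizable (X : topologicalType) : Prop :=
  exists d : X -> X -> RR,
    (forall x y, 0 <= d x y) /\
    (forall x y, d x y = 0 <-> x = y) /\
    (forall x y, d x y = d y x) /\
    (forall x y z, d x z <= d x y + d y z) /\
    (forall A : set X, open A <->
       (forall x, A x -> exists2 e : RR, 0 < e & [set y | d x y < e] `<=` A)) /\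
    (forall u : nat -> X,
       (forall e : RR, 0 < e -> exists M : nat,
          forall m n, (M <= m)%N -> (M <= n)%N -> d (u m) (u n) < e) ->
       exists l : X, forall e : RR, 0 < e -> exists M : nat,
          forall n, (M <= n)%N -> d (u n) l < e).

Definition locally_compact_hausdorff (X : topologicalType) : Prop :=
  hausdorff_space X /\
  (forall x : X, exists K : set X, compact K /\ nbhs x K).

Definition open_kernel {X : topologicalType} {T} (G : group_on T)
    (H : group_on X) (f : X -> T) : Prop :=
  open [set x : X | f x = gone G].

Definition cm_slender {T} (G : group_on T) : Prop :=
  forall (X : topologicalType) (H : group_on X),
    topological_group H -> completely_metrizable X ->
    forall f : X -> T, is_hom H G f -> open_kernel G H f.

Definition lcH_slender {T} (G : group_on T) : Prop :=
  forall (X : topologicalType) (H : group_on X),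
    topological_group H -> locally_compact_hausdorff X ->
    forall f : X -> T, is_hom H G f -> open_kernel G H f.

(* Main.v *)
Require Import Defs.
From mathcomp Require Import all_boot all_order all_algebra.
From mathcomp Require Import all_classical all_reals all_analysis.
From mathcomp Require Import Rstruct Rstruct_topology zify lra ring.

(* Suppose a homomorphism [phi] into [G] is nontrivial arbitrarily close to the
   identity.  Completeness lets one solve [y_n = x_n y_{n+1}^{j_n}] with [x_n]
   tending to the identity so fast that each nested product converges, and with
   [phi x_n <> 1].  Writing [g_n = phi x_n] and [h_n = phi y_n], the exponents
   [j_n] can be taken among the [k_i], depending on [g_0 .. g_n] only, so that
   the radical conditions first trap some [h_n] in a prescribed member of the
   limiting sequence, and then force [h_m = 1], hence [g_m = 1], for [m > n].
   For the Hawaiian earring the complete object is the set of loops under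
   concatenation, where "close to the identity" means "contained in the circles
   of large index"; that the vanishing of [phi] on such loops gives
   [phi = phi o p_N] is a van Kampen argument, in which a homotopy first
   collapses a neighbourhood of the base point in the first [N] circles. *)

Set Implicit Arguments. Unset Strict Implicit. Unset Printing Implicit Defensive.
Import Order.TTheory GRing.Theory Num.Theory numFieldNormedType.Exports.
Local Open Scope classical_set_scope.
Local Open Scope ring_scope.

(** * Nested products in groups with a limiting sequence pair *)

Section GroupOn.
Variables (T : Type) (G : group_on T).
Local Notation "x * y" := (gmul G x y).
Local Notation "1" := (gone G).
Local Notation "x ^-1" := (ginv G x).

Lemma gmul_idem x : x * x = x -> x = 1.
Proof. by move=> e; rewrite -(gmul1 G x) -(gmulV G x) -gmulA e. Qed.

Lemma gmulVr x : x * x^-1 = 1.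
Proof. by apply: gmul_idem; rewrite gmulA -(gmulA G x) gmulV -gmulA gmul1. Qed.

Lemma gmulr1 x : x * 1 = x.
Proof. by rewrite -(gmulV G x) gmulA gmulVr gmul1. Qed.

Lemma gpow1 j : gpow G 1 j = 1.
Proof. by elim: j => //= j IH; rewrite /gpow /= in IH *; rewrite IH gmul1. Qed.

End GroupOn.

(* [J] may be read off the elements already chosen, so the exponents of the
   infinite nested product can be fixed before the next factor is picked. *)
Lemma nested_product_trivial_factor T (G : group_on T) :
  admits_limiting_sequence_pair G ->
  exists J : seq T -> nat, forall g h : nat -> T,
    (forall n, h n = gmul G (g n) (gpow G (h n.+1) (J (mkseq g n.+1)))) ->
    exists n, g n = gone G.
Proof.
move=> [F [k [Finc [_ [Fmul [Frad Fcl]]]]]].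
have Fle m n : (m <= n)%N -> F m `<=` F n.
  elim: n => [|n IH]; first by rewrite leqn0 => /eqP->.
  rewrite leq_eqVlt => /orP[/eqP->//|/IH mn] x /mn; exact: Finc.
have F1 n : F n (gone G).
  by have := Frad n; rewrite eqEsubset => -[_ /(_ (gone G) erefl)]; rewrite /radical /= gpow1.
have Fk n x : F n (gpow G x (k n)) -> x = gone G.
  by move=> Fx; have : radical G (k n) (F n) x by []; rewrite Frad.
have /choice[M0 M0P] : forall gn : T * nat, exists m,
    [set gmul G (ginv G gn.1) x | x in F gn.2] `<=` F m by move=> [g n]; exact: Fmul.
(* Taking the maximum over all indices up to [n] makes the bound monotone in [n]. *)
pose M g n := (\max_(i < n.+1) M0 (g, i : nat))%N.
have MP g n x : F n (gmul G g x) -> F (M g n) x.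
  move=> Fx; apply: (Fle (M0 (g, n)) (M g n)); first
    exact: (leq_bigmax (F := fun i : 'I_n.+1 => M0 (g, i : nat)) ord_max).
  by apply: (M0P (g, n)); exists (gmul G g x) => //=; rewrite gmulA gmulV gmul1.
have Mle g m n : (m <= n)%N -> (M g m <= M g n)%N.
  move=> mn; apply/bigmax_leqP => i _.
  have lti : (i < n.+1)%N by exact: leq_trans (ltn_ord i) _.
  exact: (leq_bigmax (F := fun i : 'I_n.+1 => M0 (g, i : nat)) (Ordinal lti)).
(* Follows how the index of the member of [F] grows from [m] as the factors in [s] are cancelled one
   by one. *)
pose b m s := foldl (fun n g => M g n) m s.
have ble s m n : (m <= n)%N -> (b m s <= b n s)%N.
  by elim: s m n => //= g s IH m n mn; apply: IH; exact: Mle.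
(* The [m] with [h 0] in [F m] is unknown when the exponents are fixed, so the length of the history
   stands in for it. As long as this guess is at most [m], the inclusion of radicals keeps [h i] in
   the tracked member; from then on the triviality of the radical applies. *)
exists (fun s => k (b (size s) s)) => g h hE.
have bS m i : b m (mkseq g i.+1) = M (g i) (b m (mkseq g i)).
  by rewrite /b mkseqS -cats1 foldl_cat.
have [m hm] : exists m, F m (h 0%N).
  have [m mP] := Fmul 0%N (h 0%N); exists m; apply: mP.
  by exists (gone G) => //; exact: gmulr1.
have step n i : F (b n (mkseq g i)) (h i) ->
    F (b n (mkseq g i.+1)) (gpow G (h i.+1) (k (b i.+1 (mkseq g i.+1)))).
  by move=> Fh; rewrite bS; apply: MP; rewrite hE size_mkseq in Fh.
have low i : (i <= m)%N -> F (b m (mkseq g i)) (h i).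
  elim: i => // i IH im; apply: (Fcl _ _ (ble (mkseq g i.+1) _ _ im)).
  by apply: step; apply: IH; exact: ltnW.
have high i : (m <= i)%N -> F (b i (mkseq g i)) (h i) -> h i.+1 = gone G.
  move=> mi Fh; apply: (Fk (b i.+1 (mkseq g i.+1))).
  exact: (Fle _ _ (ble (mkseq g i.+1) _ _ (leqnSn i))) (step _ _ Fh).
have h1 : h m.+1 = gone G by apply: high => //; exact: low.
(* The identity lies in every member, so the argument repeats one step later; two consecutive
   trivial [h] leave a trivial factor between them. *)
have h2 : h m.+2 = gone G by apply: high; [exact: leqnSn | rewrite h1].
by exists m.+1; have := hE m.+1; rewrite h1 h2 gpow1 gmulr1.
Qed.

(** Dependent choice with the whole prefix as the state of the recursion. *)
Lemma history_choice (X : Type) (P : seq X -> X -> Prop) :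
  (forall s, exists x, P s x) -> exists u, forall n, P (mkseq u n) (u n).
Proof.
move=> /choice[f fP].
pose s := fix s n := if n is n'.+1 then rcons (s n') (f (s n')) else [::].
exists (fun n => f (s n)) => n; suff -> : mkseq (fun n => f (s n)) n = s n by [].
by elim: n => // n IH; rewrite mkseqS IH.
Qed.

(** * Local triviality in a space with neighbourhood filters and a continuous operation *)

Section LocallyTrivial.
Variables (T : Type) (G : group_on T) (limG : admits_limiting_sequence_pair G).
Variables (X : Type) (nb : X -> set_system X) (nbF : forall x, Filter (nb x)).
Hypothesis nb_self : forall x A, nb x A -> A x.
Variables (op : X -> X -> X) (e : X) (phi : X -> T).
Hypothesis op_cont : forall x y A, nb (op x y) A ->
  exists B C, [/\ nb x B, nb y C & forall x' y', B x' -> C y' -> A (op x' y')].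
Hypothesis op_ee : op e e = e.
Hypothesis phiM : forall x y, phi (op x y) = gmul G (phi x) (phi y).
Variables (F : set_system nat) (FF : ProperFilter F).
Hypothesis F_oo : forall n, F [set k | (n <= k)%N].
Let conv (v : nat -> X) l := forall A, nb l A -> F [set k | A (v k)].
Hypothesis conv_phi : forall v a b, conv v a -> conv v b -> phi a = phi b.
Variable Q : nat -> X -> X -> Prop.
Hypothesis nb_Q : forall n a, nb a (Q n a).
Hypothesis Q_conv : forall n (v : nat -> X), v n = e ->
  (forall k, (n <= k)%N -> Q k (v k) (v k.+1)) -> exists l, conv v l.

Let pow x j := iter j (op x) e.

Let cont (f : X -> X) := forall x A, nb (f x) A -> nb x [set z | A (f z)].

Let cont_op f g : cont f -> cont g -> cont (fun x => op (f x) (g x)).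
Proof.
move=> cf cg x A /op_cont[B [C [nB nC BCA]]].
by apply: filterS (filterI (cf _ _ nB) (cg _ _ nC)) => z -[Bz Cz]; exact: BCA.
Qed.

Let cont_cst a : cont (fun=> a).
Proof. by move=> x A /nb_self Aa; exact: filterS filterT. Qed.

Let cont_pow f j : cont f -> cont (fun x => pow (f x) j).
Proof. by move=> cf; elim: j => [|j IH]; [exact: cont_cst | exact: cont_op]. Qed.

Let nest (j : nat -> nat) (u : nat -> X) := fix nest n k z :=
  if k is k'.+1 then op (u n) (pow (nest n.+1 k' z) (j n)) else z.

Let cont_nest j u n k : cont (nest j u n k).
Proof.
elim: k n => [|k IH] n; first by move=> x A.
by apply: cont_op; [exact: cont_cst | exact: cont_pow].
Qed.

(** Unrolling at the innermost layer shows that a further factor changes only the argument [z], so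
    continuity in [z] bounds its effect. *)
Let nestSr j u n k z :
  nest j u n k.+1 z = nest j u n k (op (u (n + k)%N) (pow z (j (n + k)%N))).
Proof.
elim: k n => [|k IH] n; first by rewrite addn0.
by rewrite -addSnnS [RHS]/= -IH.
Qed.

Let eq_nest j j' u u' n k z :
  (forall i, (i < n + k)%N -> j i = j' i) ->
  (forall i, (i < n + k)%N -> u i = u' i) -> nest j u n k z = nest j' u' n k z.
Proof.
elim: k n => //= k IH n jj uu; rewrite jj ?uu ?IH ?addSnnS //; lia.
Qed.

Let phi_pow x j : phi (pow x j) = gpow G (phi x) j.
Proof.
elim: j => [|j IH]; last by rewrite /pow /= phiM IH.
by apply: gmul_idem; rewrite -phiM op_ee.
Qed.

Let pow_e j : pow e j = e.
Proof. by elim: j => // j IH; rewrite /pow /= in IH *; rewrite IH. Qed.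

(** The form covers both topological groups and loops under concatenation, taken before passing to
    homotopy classes: limits need to be unique only up to [phi], and [F] may be [\oo] or an
    ultrafilter. The relation [Q] says how little a new factor must move the truncated products for
    them to converge. *)
Lemma locally_trivial : nb e [set x | phi x = gone G].
Proof.
apply: contrapT => nontriv.
have near_e A : nb e A -> exists x, A x /\ phi x <> gone G.
  move=> nA; apply: contrapT => /forallNP H; apply: nontriv.
  by apply: filterS nA => x Ax; apply: contrapT => px; exact: (H x).
have [J JP] := nested_product_trivial_factor limG.
pose j (u : nat -> X) i := J (mkseq (phi \o u) i.+1).
(* The new factor [x] must move each truncated product, for every starting index [n] up to the
   current length, only within [Q]. The default [e] of [nth] is never reached, as [nest] reads
   indices below [size s] only. *)
pose P s x := phi x <> gone G /\ forall n, (n <= size s)%N ->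
  let w := nest (j (nth e s)) (nth e s) n (size s - n) in Q (size s) (w e) (w (op x e)).
have [u uP] : exists u, forall n, P (mkseq u n) (u n).
  apply: history_choice => s.
  have [x [xP x1]] : exists x, (forall n : 'I_(size s).+1,
      let w := nest (j (nth e s)) (nth e s) n (size s - n) in
      Q (size s) (w e) (w (op x e))) /\ phi x <> gone G.
    (* Finitely many conditions, each holding near [e]: at [x = e] both arguments of [Q] coincide
       because [op e e = e]. *)
    apply: near_e; apply: filter_forall => n /=.
    have cw : cont (fun x => nest (j (nth e s)) (nth e s) n (size s - n) (op x e)).
      move=> x A /cont_nest; apply: (cont_op _ (cont_cst (a := e))) => //.
    by apply: cw; rewrite op_ee.
  by exists x; split=> // n ns; exact: (xP (Ordinal (ns : (n < (size s).+1)%N))).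
(* The truncation of the nested product to the factors with indices from [n] to [N - 1]; it is [e]
   for [N = n]. *)
pose y n N := nest (j u) u n (N - n) e.
have yS n N : (n <= N)%N ->
    y n N.+1 = nest (j u) u n (N - n) (op (u N) e).
  by move=> nN; rewrite /y subSn // nestSr subnKC // pow_e.
have yQ n N : (n <= N)%N -> Q N (y n N) (y n N.+1).
  move=> nN; rewrite yS //; have [_] := uP N; rewrite size_mkseq => /(_ n nN) /=.
  have nthu i : (i < N)%N -> nth e (mkseq u N) i = u i by exact: nth_mkseq.
  have jE i : (i < N)%N -> j (nth e (mkseq u N)) i = j u i.
    move=> iN; congr J; apply/eq_in_map => l; rewrite mem_iota /= add0n => li.
    by rewrite nthu //; lia.
  have nE z : nest (j (nth e (mkseq u N))) (nth e (mkseq u N)) n (N - n) z =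
      nest (j u) u n (N - n) z by apply: eq_nest => i; rewrite subnKC //; auto.
  by rewrite !nE.
have /choice[l lP] : forall n, exists l, conv (y n) l.
  move=> n; apply: (Q_conv (n := n)) => [|k nk].
    by rewrite /y subnn.
  exact: yQ.
suff ly n : phi (l n) = gmul G (phi (u n)) (gpow G (phi (l n.+1)) (j u n)).
  by have [n] := JP (phi \o u) (phi \o l) ly; exact: (uP n).1.
(* For [N > n] the truncations satisfy the recursion exactly, so by continuity both sides are limits
   of [y n] along [F]. *)
rewrite -phi_pow -phiM; apply: conv_phi (lP n) _ => A nA.
have := (cont_op (cont_cst (a := u n)) (cont_pow (j := j u n) (f := id) _)).
move=> /(_ (fun x A => id)) /(_ _ _ nA) /lP Fy; apply: filterS (filterI (F_oo n.+1) Fy) => N [/= nN].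
by rewrite /y subnS; case: (N - n)%N (subn_gt0 n N) => [|k _] //=; rewrite nN.
Qed.

End LocallyTrivial.

(** * Completely metrizable and locally compact groups *)

Lemma open_kernel_nbhs (X : topologicalType) (H : group_on X) T (G : group_on T)
    (f : X -> T) : topological_group H -> is_hom H G f ->
  nbhs (gone H) [set x | f x = gone G] -> open_kernel G H f.
Proof.
move=> [cM _] fM f1; rewrite /open_kernel openE => x /= fx1.
have c : (fun y => gmul H (ginv H x) y) @ x --> gone H.
  rewrite -(gmulV H x); apply: (@continuous_comp _ _ _ (fun y => (ginv H x, y))
    (fun q => gmul H q.1 q.2)).
    by apply: cvg_pair; [exact: cvg_cst | exact: cvg_id].
  exact: cM.
apply: (@filterS _ (nbhs x) _ _ _ _ (c _ f1)) => y /=; rewrite fM => e.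
by rewrite -[y](gmul1 H) -(gmulVr H x) -gmulA fM fx1 gmul1 fM.
Qed.

Lemma open_kernel_complete T (G : group_on T) (X : topologicalType)
    (H : group_on X) (f : X -> T) (F : set_system nat) (Q : nat -> X -> X -> Prop) :
  admits_limiting_sequence_pair G -> topological_group H -> hausdorff_space X ->
  is_hom H G f -> ProperFilter F -> (forall n, F [set k | (n <= k)%N]) ->
  (forall n a, nbhs a (Q n a)) ->
  (forall n (v : nat -> X), v n = gone H ->
    (forall k, (n <= k)%N -> Q k (v k) (v k.+1)) -> exists l : X, v @ F --> l) ->
  open_kernel G H f.
Proof.
move=> limG tH hX fM FF Foo nQ Qc; apply: open_kernel_nbhs => //.
apply: (@locally_trivial T G limG X (@nbhs X X) _ _ (gmul H) (gone H) f _ _ _ F _ _ _ Q) => //.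
- by move=> x A; exact: nbhs_singleton.
- move=> x y A /(tH.1 (x, y))[[B C] /= [nB nC] BCA].
  by exists B, C; split=> // x' y' Bx Cy; exact: (BCA (x', y')).
- exact: gmul1.
- by move=> v a b va vb; congr f; apply: (@cvg_unique _ hX (v @ F)).
Qed.

Lemma admits_cm_slender T (G : group_on T) :
  admits_limiting_sequence_pair G -> cm_slender G.
Proof.
move=> limG X H tH [d [d0 [deq [dC [dT [dO dcomp]]]]]] f fM.
have ballO x e : open [set y | d x y < e].
  apply/dO => y /= xy; exists (e - d x y); first by rewrite subr_gt0.
  by move=> z /=; rewrite ltrBrDl; apply: le_lt_trans; exact: dT.
have dxx x : d x x = 0 by exact/deq.
have ballN x e : 0 < e -> nbhs x [set y | d x y < e].
  by move=> e0; apply: open_nbhs_nbhs; split=> //=; rewrite dxx.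
have hX : hausdorff_space X.
  move=> x y cxy; apply/deq/eqP; rewrite eq_le d0 andbT; apply/ler_addgt0Pr => e e0.
  rewrite add0r; have e2 : 0 < e / 2 by rewrite divr_gt0.
  have [z [/= xz yz]] := cxy _ _ (ballN x _ e2) (ballN y _ e2).
  apply: le_trans (dT _ z _) _; rewrite (dC z); lra.
(* Steps below [2^-n] are summable, hence the truncated products form a Cauchy sequence. *)
apply: (@open_kernel_complete _ _ _ _ _ \oo (fun n a b => d a b < (2^-1 : RR) ^+ n)) => //.
- by move=> n; exists n.
- by move=> n a; apply: ballN; rewrite exprn_gt0.
move=> n v _ vQ.
have vd k m : (n <= k)%N -> d (v k) (v (k + m)%N) <= 2 * (2^-1) ^+ k.
  (* The subtracted term makes the geometric bound provable by induction on [m]. *)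
  move=> nk; suff : d (v k) (v (k + m)%N) <= 2 * (2^-1) ^+ k - 2 * (2^-1) ^+ (k + m).
    by move/le_trans; apply; rewrite gerBl mulr_ge0 // exprn_ge0.
  elim: m => [|m IH]; first by rewrite addn0 dxx subrr.
  have := vQ (k + m)%N (leq_trans nk (leq_addr _ _)); rewrite addnS => vm.
  apply: le_trans (dT _ (v (k + m)%N) _) _; rewrite exprS; lra.
have [|l lP] := dcomp v.
  move=> e e0.
  have [M _ MP] : \forall M \near \oo, 4 * (2^-1 : RR) ^+ M < e.
    have : (fun M => 4 * (2^-1 : RR) ^+ M) @ \oo --> (4 * 0 : RR).
      apply: cvgM; first exact: cvg_cst.
      by apply: cvg_expr; rewrite gtr0_norm //; lra.
    by rewrite mulr0 => /cvgr_lt; apply.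
  have {}MP := MP (maxn n M) (leq_maxr _ _); exists (maxn n M) => p q Mp Mq.
  apply: le_lt_trans MP; apply: le_trans (dT _ (v (maxn n M)) _) _.
  have := vd (maxn n M) (p - maxn n M)%N (leq_maxl _ _).
  have := vd (maxn n M) (q - maxn n M)%N (leq_maxl _ _).
  rewrite !subnKC // (dC (v p)); lra.
exists l => A; rewrite nbhsE => -[B [Bo Bl] BA].
have [e e0 eB] := (dO B).1 Bo l Bl; have [M MP] := lP e e0.
by exists M => // k /= Mk; apply/BA/eB => /=; rewrite dC; exact: MP.
Qed.

(** It suffices to keep all truncated products inside a compact neighbourhood of the identity: an
    ultrafilter then converges there, with no smallness condition on the steps. *)
Lemma admits_lcH_slender T (G : group_on T) :
  admits_limiting_sequence_pair G -> lcH_slender G.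
Proof.
move=> limG X H tH [hX lc] f fM.
have [K [cK nK]] := lc (gone H).
have [F [uF ooF]] := ultraFilterLemma (F := \oo) _.
apply: (@open_kernel_complete _ _ _ _ _ F (fun=> fun a b => K^° a -> K^° b)) => //.
- by move=> n; apply: ooF; exists n.
- move=> _ a; have [Ka|nKa] := pselect (K^° a); last by apply: filterS filterT.
  by apply: filterS (open_nbhs_nbhs (conj (open_interior K) Ka)) => b.
move=> n v vn vQ.
have vK k : (n <= k)%N -> K^° (v k).
  elim: k => [|k IH]; first by rewrite leqn0 => /eqP <-; rewrite vn.
  rewrite leq_eqVlt => /orP[/eqP <-|nk]; first by rewrite vn.
  exact: (vQ k nk (IH nk)).
have [|l [_ lP]] := cK (v @ F) _.
  by apply: ooF; exists n => // k /= nk; apply: interior_subset; exact: vK.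
(* A cluster point of an ultrafilter is a limit: otherwise the complement of a neighbourhood would
   belong to it. *)
exists l => A nA; have [//|FA] := in_ultra_setVsetC (v @^-1` A) uF.
by have [z [nz Az]] := lP _ _ (FA : (v @ F) (~` A)) nA.
Qed.

(** * Geometry of the earring *)

(** Precomposing with this retraction of the line onto the unit interval turns continuity within the
    interval into global continuity. *)
Definition clamp (s : RR) : RR := Num.max 0 (Num.min 1 s).

Lemma clampP s : unit_interval (clamp s).
Proof.
by rewrite /unit_interval /clamp /= le_max lexx /= ge_max ler01 ge_min lexx.
Qed.

Lemma clamp_id s : unit_interval s -> clamp s = s.
Proof. by move=> /andP[s0 s1]; rewrite /clamp (min_idPr s1) (max_idPr s0). Qed.

Lemma clamp_le0 s : s <= 0 -> clamp s = 0.
Proof. by move=> s0; rewrite /clamp; apply/max_idPl; rewrite ge_min s0 orbT. Qed.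

Lemma clamp_ge1 s : 1 <= s -> clamp s = 1.
Proof. by move=> s1; rewrite /clamp (min_idPl s1); apply/max_idPr. Qed.

Lemma le_clamp s r : s <= r -> clamp s <= clamp r.
Proof.
move=> sr; rewrite /clamp ge_max le_max lexx /= le_max; apply/orP; right.
by rewrite le_min !ge_min lexx sr orbT.
Qed.

Lemma clamp_continuous : continuous clamp.
Proof.
have c0 : continuous (cst 0 : RR -> RR^o) by move=> s; exact: cvg_cst.
have c1 : continuous (fun s : RR => Num.min 1 s : RR^o).
  have c1 : continuous (cst 1 : RR -> RR^o) by move=> s; exact: cvg_cst.
  by move=> s; have := @continuous_min _ _ _ (id : RR -> RR^o) s (c1 s) cvg_id.
by move=> s; have := continuous_max (c0 s) (c1 s).
Qed.

Lemma within_clamp (g : RR -> pt) :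
  {within unit_interval, continuous g} <-> continuous (g \o clamp).
Proof.
split=> [/subspace_continuousP cg s | cg].
  apply: cvg_comp (cg _ (clampP s)) => A /clamp_continuous; rewrite !nbhs_simpl /=.
  by apply: filterS => r; apply; exact: clampP.
apply/subspace_continuousP => s Is.
have := cg s; rewrite /continuous_at /= (clamp_id Is) => cgs A /cgs.
by apply: (@filterS _ (nbhs s)) => r /= + Ir; rewrite (clamp_id Ir).
Qed.

Definition sqn (p : pt) : RR := p.1 ^+ 2 + p.2 ^+ 2.

Lemma sqn_ge0 p : 0 <= sqn p.
Proof. by rewrite addr_ge0 // sqr_ge0. Qed.

Lemma sqn_eq0 p : (sqn p == 0) = (p == base).
Proof. by rewrite paddr_eq0 ?sqr_ge0 // !sqrf_eq0; case: p. Qed.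

Lemma circleE n p : circle n p <-> sqn p * n.+1%:R = 2 * p.2.
Proof.
rewrite /circle /sqn /=; have n0 : (n.+1%:R : RR) != 0 by [].
set a : RR := n.+1%:R in n0 *; split=> h.
  have -> : p.1 ^+ 2 = a^-1 ^+ 2 - (p.2 - a^-1) ^+ 2 by rewrite -h; ring.
  by field.
apply: (mulIf n0); have -> : (p.1 ^+ 2 + (p.2 - a^-1) ^+ 2) * a =
  (p.1 ^+ 2 + p.2 ^+ 2) * a - 2 * p.2 + a^-1 by field.
by rewrite h; field.
Qed.

Lemma circle_base n : circle n base.
Proof. by apply/circleE; rewrite /sqn /= expr0n /= addr0 mul0r mulr0. Qed.

Lemma circle_inj n m p : p != base -> circle n p -> circle m p -> n = m.
Proof.
rewrite -sqn_eq0 => p0 /circleE nE /circleE; rewrite -nE => /(mulfI p0)/eqP.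
by rewrite eqr_nat => /eqP[].
Qed.

Definition tail_circles (N : nat) (p : pt) := exists2 n, (N <= n)%N & circle n p.
Definition head_circles (N : nat) (p : pt) := exists2 n, (n < N)%N & circle n p.

Lemma tail_base N : tail_circles N base.
Proof. by exists N => //; exact: circle_base. Qed.

Lemma earring_base : earring base.
Proof. by exists 0%N => //; exact: circle_base. Qed.

Lemma earring_cover N p : earring p -> head_circles N p \/ tail_circles N p.
Proof. by move=> [n _ np]; case: (ltnP n N) => nN; [left|right]; exists n. Qed.

Lemma head_tail N p : head_circles N p -> tail_circles N p -> p = base.
Proof.
move=> [n nN np] [m mN mp]; apply/eqP; apply: contraLR isT => p0.
by have := circle_inj p0 np mp; lia.
Qed.

Lemma tail_sqn N p : tail_circles N p -> sqn p * N.+1%:R ^+ 2 <= 4.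
Proof.
move=> [n Nn /circleE np]; have := sqn_ge0 p => p0.
have : (N.+1%:R : RR) <= n.+1%:R by rewrite ler_nat.
have : (0 : RR) < N.+1%:R by [].
have : sqn p * n.+1%:R ^+ 2 <= 4.
  have : p.2 ^+ 2 <= sqn p by rewrite lerDr sqr_ge0.
  have : (0 : RR) < n.+1%:R by [].
  set a : RR := n.+1%:R in np *.
  set q := sqn p in np p0 *.
  move=> a0 yq; have [->|q0] := eqVneq q 0; first by rewrite mul0r.
  have qp : 0 < q by rewrite lt_neqAle eq_sym q0.
  by rewrite -(ler_pM2l qp); nra.
set a : RR := n.+1%:R; set b : RR := N.+1%:R => h b0 ba.
apply: le_trans h; apply: ler_wpM2l => //; rewrite ler_sqr ?nnegrE; lra.
Qed.

Lemma head_retractN N p : head_circles N p -> retractN N p = p.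
Proof. by rewrite /retractN => hp; case: asboolP. Qed.

Lemma tail_retractN N p : tail_circles N p -> retractN N p = base.
Proof. by move=> tp; rewrite /retractN; case: asboolP => // /head_tail; apply. Qed.

Lemma cvg_pt (Z : topologicalType) (f : Z -> pt) z :
  (fst \o f) @ z --> (f z).1 -> (snd \o f) @ z --> (f z).2 -> f @ z --> f z.
Proof.
move=> f1 f2.
have : (fun y => ((fst \o f) y, (snd \o f) y)) @ z --> ((f z).1, (f z).2).
  exact: (cvg_pair (FG := nbhs_filter (f z).1) (FH := nbhs_filter (f z).2) f1 f2).
rewrite -surjective_pairing (_ : (fun y => _) = f) //.
by apply/funext => y /=; rewrite -surjective_pairing.
Qed.

Lemma fst_cvg (Z : topologicalType) (f : Z -> pt) z :
  f @ z --> f z -> (fst \o f) @ z --> (f z).1.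
Proof. by move=> cf; apply: cvg_comp cf _; exact: cvg_fst. Qed.

Lemma snd_cvg (Z : topologicalType) (f : Z -> pt) z :
  f @ z --> f z -> (snd \o f) @ z --> (f z).2.
Proof. by move=> cf; apply: cvg_comp cf _; exact: cvg_snd. Qed.

Lemma sqn_cvg (Z : topologicalType) (f : Z -> pt) z :
  f @ z --> f z -> (sqn \o f) @ z --> sqn (f z).
Proof.
move=> cf; have f1 := fst_cvg cf; have f2 := snd_cvg cf.
exact: (cvgD (cvgM f1 f1) (cvgM f2 f2)).
Qed.

Lemma cvg0_sqr (Z : topologicalType) (u w : Z -> RR) (z : Z) :
  (forall y, u y ^+ 2 <= w y) -> w @ z --> (0 : RR) -> u @ z --> (0 : RR).
Proof.
move=> uw w0; apply: (@cvgr0Pnorm_lt _ RR^o Z (nbhs z) _ u).2 => e e0.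
have := (@cvgr0Pnorm_lt _ RR^o Z (nbhs z) _ w).1 w0 (e ^+ 2).
rewrite exprn_gt0 // => /(_ _ isT).
apply: filterS => y wy; rewrite -(@ltr_pXn2r _ 2) ?nnegrE ?(ltW e0) //.
by rewrite real_normK ?num_real //;
  apply: le_lt_trans (uw y) _; apply: le_lt_trans wy; exact: ler_norm.
Qed.

(* Circles accumulate only at [base], where a norm-decreasing map is
   automatically continuous; elsewhere an ambient formula can be used. *)
Lemma continuous_off_base (Z : topologicalType) (g f : Z -> pt) :
  continuous g -> (forall z, sqn (f z) <= sqn (g z)) ->
  (forall z, g z != base -> f @ z --> f z) -> continuous f.
Proof.
move=> cg fg cf z; have [gz|] := eqVneq (g z) base; last exact: cf.
have sg : (sqn \o g) @ z --> (0 : RR).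
  by have := sqn_cvg (cg z); rewrite gz /sqn /= expr0n /= addr0.
have /eqP fz : f z == base.
  by rewrite -sqn_eq0 eq_le sqn_ge0 andbT (le_trans (fg z)) // gz /sqn /= expr0n /= addr0.
apply: cvg_pt; rewrite fz; apply: cvg0_sqr sg => y /=; apply: le_trans (fg y);
  by rewrite ?lerDl ?lerDr sqr_ge0.
Qed.

(** The inverse radius of the circle through [base] and [p] centred on the vertical axis, by
    [circleE]; it is continuous off [base]. *)
Definition circle_index (p : pt) : RR := 2 * p.2 / sqn p.

Lemma index_circle n p : p != base -> circle n p -> circle_index p = n.+1%:R.
Proof. by rewrite -sqn_eq0 /circle_index => p0 /circleE <-; rewrite mulrC mulKf. Qed.

Lemma index_cvg (Z : topologicalType) (f : Z -> pt) z : f z != base ->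
  f @ z --> f z -> (circle_index \o f) @ z --> circle_index (f z).
Proof.
rewrite -sqn_eq0 => f0 cf; apply: cvgM; last exact: (cvgV f0 (sqn_cvg cf)).
by apply: cvgM; [exact: cvg_cst | exact: snd_cvg].
Qed.

Lemma clamp_cvg (Z : topologicalType) (f : Z -> RR) (z : Z) a :
  f @ z --> a -> (clamp \o f) @ z --> clamp a.
Proof. by move=> cf; apply: cvg_comp cf _; exact: clamp_continuous. Qed.

(** A continuous substitute, off [base], for the indicator of the first [N] circles: the index is an
    integer on the earring, so only the values 0 and 1 occur there. *)
Definition low (N : nat) (p : pt) : RR := clamp (N.+1%:R - circle_index p).

Lemma low_head N p : p != base -> head_circles N p -> low N p = 1.
Proof.
move=> p0 [n nN np]; rewrite /low (index_circle p0 np) clamp_ge1 //.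
have : (n.+1%:R : RR) <= N%:R by rewrite ler_nat.
by rewrite -(natr1 N); lra.
Qed.

Lemma low_tail N p : p != base -> tail_circles N p -> low N p = 0.
Proof.
move=> p0 [n nN np]; rewrite /low (index_circle p0 np) clamp_le0 //.
by rewrite subr_le0 ler_nat.
Qed.

Lemma low_cvg (Z : topologicalType) N (f : Z -> pt) z : f z != base ->
  f @ z --> f z -> (low N \o f) @ z --> low N (f z).
Proof.
move=> f0 cf; apply: (clamp_cvg (f := fun z => N.+1%:R - circle_index (f z))).
by apply: (@cvgB _ RR^o); [exact: cvg_cst | exact: index_cvg].
Qed.

(** Replaces the case distinction in [retractN] by a formula whose continuity off [base] is
    evident. *)
Lemma retractN_low N p : earring p ->
  retractN N p = (low N p * p.1, low N p * p.2).
Proof.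
have [->|p0] := eqVneq p base.
  by move=> _; rewrite (tail_retractN (tail_base N)) /= !mulr0.
case/(earring_cover N) => h.
  by rewrite (head_retractN h) (low_head p0 h) !mul1r -surjective_pairing.
by rewrite (tail_retractN h) (low_tail p0 h) !mul0r.
Qed.

Lemma retractN_continuous (Z : topologicalType) N (g : Z -> pt) :
  continuous g -> (forall z, earring (g z)) -> continuous (retractN N \o g).
Proof.
move=> cg Eg; apply: (continuous_off_base cg) => z.
  rewrite /= /retractN; case: asboolP => // _.
  by rewrite {1}/sqn /= expr0n /= addr0 sqn_ge0.
move=> gz; have cl := low_cvg (N := N) gz (cg z).
have -> : retractN N \o g = fun z => (low N (g z) * (g z).1, low N (g z) * (g z).2).
  by apply/funext => y /=; rewrite retractN_low.
apply: (@cvg_pt _ (fun z => (low N (g z) * (g z).1, low N (g z) * (g z).2))).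
  by apply: cvgM => //; exact: (fst_cvg (cg z)).
by apply: cvgM => //; exact: (snd_cvg (cg z)).
Qed.

(* Scaling the slope of the chord from [base] to [p] by [l] while staying on
   the circle through [base] and [p] centred on the vertical axis. *)
Definition shrink (l : RR) (p : pt) : pt :=
  let c := sqn p * l / (p.1 ^+ 2 + (l * p.2) ^+ 2) in (c * p.1, c * (l * p.2)).

Lemma shrink_base l : shrink l base = base.
Proof. by rewrite /shrink /= !mulr0. Qed.

Lemma shrink1 p : shrink 1 p = p.
Proof.
have [->|] := eqVneq p base; first exact: shrink_base.
rewrite -sqn_eq0 /shrink mulr1 mul1r => p0.
by rewrite -/(sqn p) divff // !mul1r -surjective_pairing.
Qed.

Lemma shrink0 p : shrink 0 p = base.
Proof. by rewrite /shrink mulr0 !mul0r. Qed.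

Lemma sqn_shrink l p :
  sqn (shrink l p) = sqn p ^+ 2 * l ^+ 2 / (p.1 ^+ 2 + (l * p.2) ^+ 2).
Proof.
rewrite /shrink {1}/sqn /=; set D := p.1 ^+ 2 + (l * p.2) ^+ 2.
have [->|D0] := eqVneq D 0; first by rewrite invr0 !mulr0 !mul0r expr0n /= addr0.
rewrite !exprMn -mulrDr -(exprMn _ l p.2) -/D expr2; by field.
Qed.

Lemma sqn_shrink_le l p : unit_interval l -> sqn (shrink l p) <= sqn p.
Proof.
move=> /andP[l0 l1]; rewrite sqn_shrink; set D := p.1 ^+ 2 + (l * p.2) ^+ 2.
have D0 : 0 <= D by rewrite addr_ge0 // sqr_ge0.
have [->|Dn0] := eqVneq D 0; first by rewrite invr0 mulr0 sqn_ge0.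
have Dp : 0 < D by rewrite lt_neqAle eq_sym Dn0.
rewrite ler_pdivrMr // expr2 -mulrA ler_wpM2l ?sqn_ge0 //.
rewrite /D /sqn exprMn mulrDl [X in _ + X]mulrC lerD2r.
by rewrite ler_piMr ?sqr_ge0 // exprn_ile1.
Qed.

Lemma circle_shrink n l p : circle n p -> circle n (shrink l p).
Proof.
move=> /circleE np; apply/circleE; rewrite sqn_shrink /shrink /=.
set D' := (_ + _)^-1.
have -> : sqn p ^+ 2 * l ^+ 2 * D' * n.+1%:R = sqn p * l ^+ 2 * D' * (sqn p * n.+1%:R).
  by ring.
by rewrite np; ring.
Qed.

(** The slope factor of the collapse. On the first [N] circles it is [1 - t] where [N^2 |p|^2 <= 1]
    and 1 where [N^2 |p|^2 >= 2]; on the other circles it is 1. *)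
Definition bend (N : nat) (t : RR) (p : pt) : RR :=
  1 - t * (low N p * clamp (2 - N%:R ^+ 2 * sqn p)).

(* Homotopy of the earring from the identity to a map collapsing an arc around
   [base] in each of the first [N] circles and fixing the other circles. *)
Definition push (N : nat) (t : RR) (p : pt) : pt := shrink (bend N t p) p.

Lemma bend_unit N t p : unit_interval t -> unit_interval (bend N t p).
Proof.
move=> /andP[t0 t1]; rewrite /bend /low.
have /andP[a0 a1] := clampP (N.+1%:R - circle_index p).
have /andP[b0 b1] := clampP (2 - N%:R ^+ 2 * sqn p).
set a := clamp _ in a0 a1 *; set b := clamp _ in b0 b1 *.
rewrite /unit_interval /= subr_ge0 lerBlDr lerDl !mulr_ge0 // andbT.
by rewrite !mulr_ile1 // mulr_ge0.
Qed.

Lemma push0 N p : push N 0 p = p.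
Proof. by rewrite /push /bend mul0r subr0 shrink1. Qed.

Lemma push_tail N t p : tail_circles N p -> push N t p = p.
Proof.
have [->|p0] := eqVneq p base; first by rewrite /push shrink_base.
by move=> tp; rewrite /push /bend low_tail // mul0r mulr0 subr0 shrink1.
Qed.

Lemma push_head N t p : head_circles N p -> head_circles N (push N t p).
Proof. by move=> [n nN np]; exists n => //; exact: circle_shrink. Qed.

Lemma push_earring N t p : earring p -> earring (push N t p).
Proof. by move=> [n _ np]; exists n => //; exact: circle_shrink. Qed.

Lemma push1_near_base N p : head_circles N p -> N%:R ^+ 2 * sqn p <= 1 -> push N 1 p = base.
Proof.
have [->|p0] := eqVneq p base; first by rewrite /push shrink_base.
move=> hp pN; rewrite /push /bend low_head // mul1r mul1r clamp_ge1; last by lra.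
by rewrite subrr shrink0.
Qed.

(** Off [base], the earring meets the vertical axis only in the tops of circles. Those of the first
    [N] circles have height at least [2 / N], where the cutoff vanishes. This keeps the denominator
    in [shrink] nonzero when [push] is shown continuous. *)
Lemma bend_axis N t p : p != base -> earring p -> p.1 = 0 -> bend N t p = 1.
Proof.
move=> p0 Ep p1; have [hp|tp] := earring_cover N Ep; last first.
  by rewrite /bend low_tail // mul0r mulr0 subr0.
rewrite /bend clamp_le0 ?mulr0 ?subr0 //; case: hp => n nN /circleE.
have : 0 < sqn p by rewrite lt_neqAle eq_sym sqn_eq0 p0 sqn_ge0.
have nN' : (n.+1%:R : RR) <= N%:R by rewrite ler_nat.
have n0 : (0 : RR) < n.+1%:R by [].
rewrite /sqn p1 expr0n /= add0r; set y := p.2; set a : RR := n.+1%:R in nN' n0 *.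
move=> y0 ya; have y1 : y != 0 by rewrite -(@sqrf_eq0 _ y) gt_eqF.
have {}ya : a * y = 2 by apply: (mulIf y1); rewrite -ya; ring.
rewrite subr_le0; apply: (@le_trans _ _ (a ^+ 2 * y ^+ 2)).
  by rewrite -exprMn ya; lra.
by rewrite ler_wpM2r ?sqr_ge0 // ler_sqr ?nnegrE; lra.
Qed.

Lemma push_continuous (Z : topologicalType) N (t : Z -> RR) (g : Z -> pt) :
  continuous t -> (forall z, unit_interval (t z)) ->
  continuous g -> (forall z, earring (g z)) ->
  continuous (fun z => push N (t z) (g z)).
Proof.
move=> ct It cg Eg; apply: (continuous_off_base cg) => z.
  exact/sqn_shrink_le/bend_unit.
move=> gz; have cl := low_cvg (N := N) gz (cg z).
have cs := sqn_cvg (cg z); have c1 := fst_cvg (cg z); have c2 := snd_cvg (cg z).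
have cb : (fun z => bend N (t z) (g z)) @ z --> bend N (t z) (g z).
  apply: (@cvgB _ RR^o); first exact: cvg_cst.
  apply: cvgM; first exact: ct.
  apply: cvgM => //; apply: (clamp_cvg (f := fun z => 2 - N%:R ^+ 2 * sqn (g z))).
  by apply: (@cvgB _ RR^o); [exact: cvg_cst | apply: cvgM => //; exact: cvg_cst].
have D0 : (g z).1 ^+ 2 + (bend N (t z) (g z) * (g z).2) ^+ 2 != 0.
  rewrite paddr_eq0 ?sqr_ge0 // !sqrf_eq0; apply/negP => /andP[/eqP g1].
  rewrite bend_axis // mul1r => /eqP g2.
  by move/eqP: gz; apply; rewrite (surjective_pairing (g z)) g1 g2.
have cc : (fun z => sqn (g z) * bend N (t z) (g z) /
    ((g z).1 ^+ 2 + (bend N (t z) (g z) * (g z).2) ^+ 2)) @ z -->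
    sqn (g z) * bend N (t z) (g z) /
    ((g z).1 ^+ 2 + (bend N (t z) (g z) * (g z).2) ^+ 2).
  apply: cvgM; first exact: cvgM.
  apply: (cvgV D0); rewrite !expr2; apply: (@cvgD _ RR^o); first exact: (cvgM c1 c1).
  exact: (cvgM (cvgM cb c2) (cvgM cb c2)).
apply: (@cvg_pt _ (fun z => push N (t z) (g z))); first exact: (cvgM cc c1).
exact: (cvgM cc (cvgM cb c2)).
Qed.

(** * Loops in the earring *)

Lemma loop_intro (g h : RR -> pt) : continuous h ->
  (forall s, unit_interval s -> g s = h s) ->
  (forall s, unit_interval s -> earring (g s)) ->
  g 0 = base -> g 1 = base -> loop g.
Proof.
move=> ch gh Eg g0 g1; split=> //; apply/within_clamp.
have -> : g \o clamp = h \o clamp by apply/funext => s /=; rewrite gh //; exact: clampP.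
by move=> s; apply: continuous_comp; [exact: clamp_continuous | exact: ch].
Qed.

Lemma loop_continuous g : loop g -> continuous (g \o clamp).
Proof. by move=> [/within_clamp]. Qed.

Lemma loop_earring g s : loop g -> earring (g (clamp s)).
Proof. by move=> [_ [Eg _]]; apply: Eg; exact: clampP. Qed.

Lemma unit0 : unit_interval 0. Proof. by rewrite /unit_interval /= lexx ler01. Qed.
Lemma unit1 : unit_interval 1. Proof. by rewrite /unit_interval /= lexx ler01. Qed.

Lemma homotopic_intro (g h : RR -> pt) (Hm : RR * RR -> pt) : continuous Hm ->
  (forall q, earring (Hm q)) ->
  (forall s, unit_interval s -> Hm (s, 0) = g s) ->
  (forall s, unit_interval s -> Hm (s, 1) = h s) ->
  (forall t, Hm (0, t) = base /\ Hm (1, t) = base) -> homotopic g h.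
Proof.
move=> cH EH H0 H1 Hb; exists Hm; split; first exact: continuous_subspaceT.
by split=> [q _|]; [exact: EH|do 2 split=> //].
Qed.

Lemma loop_reparam g (eta : RR -> RR) : loop g -> continuous eta ->
  g (clamp (eta 0)) = base -> g (clamp (eta 1)) = base ->
  loop (fun s => g (clamp (eta s))).
Proof.
move=> lg ce e0 e1; apply: (@loop_intro _ (fun s => g (clamp (eta s)))) => // [s|s _].
  exact: (continuous_comp (ce s) (loop_continuous lg (x := eta s))).
exact: loop_earring.
Qed.

(** The straight line between the two parameter changes gives the homotopy. *)
Lemma homotopic_reparam g (eta eta' : RR -> RR) : loop g ->
  continuous eta -> continuous eta' -> eta 0 = eta' 0 -> eta 1 = eta' 1 ->
  g (clamp (eta 0)) = base -> g (clamp (eta 1)) = base ->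
  homotopic (fun s => g (clamp (eta s))) (fun s => g (clamp (eta' s))).
Proof.
move=> lg ce ce' ee0 ee1 e0 e1.
pose th (q : RR * RR) := (1 - q.2) * eta q.1 + q.2 * eta' q.1.
have cth : continuous th.
  move=> q; have c1 : fst @ q --> q.1 by exact: cvg_fst.
  have c2 : snd @ q --> q.2 by exact: cvg_snd.
  have E1 : (fun q => eta q.1) @ q --> eta q.1 by exact: (cvg_comp _ _ c1 (ce q.1)).
  have E2 : (fun q => eta' q.1) @ q --> eta' q.1 by exact: (cvg_comp _ _ c1 (ce' q.1)).
  have d : (fun q : RR * RR => 1 - q.2) @ q --> (1 - q.2 : RR).
    by apply: (@cvgB _ RR^o) => //; exact: cvg_cst.
  exact: (@cvgD _ RR^o _ _ _ _ _ _ _ (cvgM d E1) (cvgM c2 E2)).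
apply: (@homotopic_intro _ _ (fun q => g (clamp (th q)))) => [q|q|s _|s _|t].
- exact: (continuous_comp (cth q) (loop_continuous lg (x := th q))).
- exact: loop_earring.
- by rewrite /th /= subr0 mul1r mul0r addr0.
- by rewrite /th /= subrr mul1r mul0r add0r.
- by rewrite /th /= -ee0 -ee1 -!mulrDl subrK !mul1r.
Qed.

Lemma loop_cst : loop (fun=> base).
Proof.
apply: (@loop_intro _ (fun=> base)) => // [s|s _]; first exact: cvg_cst.
exact: earring_base.
Qed.

Lemma affine_continuous (a b : RR) : continuous (fun s : RR => a + b * s).
Proof.
move=> s; apply: (@cvgD _ RR^o); first exact: cvg_cst.
by apply: cvgM; [exact: cvg_cst | exact: cvg_id].
Qed.

(** At every time one of the two clamped loops rests at [base], the origin, so concatenation is a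
    sum and its continuity needs no gluing. *)
Lemma concat_clamp g h s : loop g -> loop h -> unit_interval s ->
  concat g h s = ((g (clamp (2 * s))).1 + (h (clamp (2 * s - 1))).1,
                  (g (clamp (2 * s))).2 + (h (clamp (2 * s - 1))).2).
Proof.
move=> [_ [_ [_ g1]]] [_ [_ [h0 _]]] /andP[s0 s1]; rewrite /concat; case: leP => s2.
  rewrite (@clamp_id (2 * s)); last by rewrite /unit_interval /=; lra.
  by rewrite clamp_le0 ?h0 /= ?addr0 -?surjective_pairing //; lra.
rewrite (@clamp_ge1 (2 * s)) ?g1 /= ?add0r; last by lra.
by rewrite clamp_id -?surjective_pairing // /unit_interval /=; lra.
Qed.

Lemma loop_concat g h : loop g -> loop h -> loop (concat g h).
Proof.
move=> lg lh; pose k s := ((g (clamp (2 * s))).1 + (h (clamp (2 * s - 1))).1,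
  (g (clamp (2 * s))).2 + (h (clamp (2 * s - 1))).2).
apply: (@loop_intro _ k).
- move=> s; have cg : (fun s => g (clamp (2 * s))) @ s --> g (clamp (2 * s)).
    have c2 : (fun s : RR => 2 * s) @ s --> (2 * s : RR).
      by apply: cvgM; [exact: cvg_cst | exact: cvg_id].
    exact: (cvg_comp _ _ c2 (loop_continuous lg (x := 2 * s))).
  have ch : (fun s => h (clamp (2 * s - 1))) @ s --> h (clamp (2 * s - 1)).
    have c2 : (fun s : RR => 2 * s - 1) @ s --> (2 * s - 1 : RR).
      apply: (@cvgB _ RR^o); last exact: cvg_cst.
      by apply: cvgM; [exact: cvg_cst | exact: cvg_id].
    exact: (cvg_comp _ _ c2 (loop_continuous lh (x := 2 * s - 1))).
  apply: (@cvg_pt _ k).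
    exact: (@cvgD _ RR^o _ _ _ _ _ _ _ (fst_cvg cg) (fst_cvg ch)).
  exact: (@cvgD _ RR^o _ _ _ _ _ _ _ (snd_cvg cg) (snd_cvg ch)).
- by move=> s Is; exact: concat_clamp.
- move=> s /andP[s0 s1]; rewrite /concat; case: leP => s2.
    by apply: lg.2.1; rewrite /unit_interval /=; lra.
  by apply: lh.2.1; rewrite /unit_interval /=; lra.
- by rewrite /concat invr_ge0 ler0n mulr0; exact: lg.2.2.1.
- rewrite /concat mulr1 ifF; last by apply/negbTE; rewrite -ltNge; lra.
  by rewrite (_ : 2 - 1 = 1) ?lh.2.2.2 //; lra.
Qed.

Lemma loop_retractN N g : loop g -> loop (retractN N \o g).
Proof.
move=> lg; have cr := retractN_continuous (N := N) (loop_continuous lg)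
  (fun s => loop_earring s lg).
apply: (loop_intro cr) => [s Is|s Is||] /=.
- by rewrite clamp_id.
- rewrite /retractN; case: asboolP => _; last exact: earring_base.
  exact: lg.2.1.
- by rewrite lg.2.2.1 (tail_retractN (tail_base N)).
- by rewrite lg.2.2.2 (tail_retractN (tail_base N)).
Qed.

Lemma loop_push N g : loop g -> loop (push N 1 \o g).
Proof.
move=> lg; have := @push_continuous _ N (fun=> 1) (g \o clamp).
move=> /(_ (fun s => cvg_cst _) (fun=> unit1) (loop_continuous lg)
  (fun s => loop_earring s lg)) cp.
apply: (loop_intro cp) => [s Is|s Is||] /=.
- by rewrite clamp_id.
- exact/push_earring/lg.2.1.
- by rewrite lg.2.2.1 push_tail //; exact: tail_base.
- by rewrite lg.2.2.2 push_tail //; exact: tail_base.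
Qed.

Lemma homotopic_push N g : loop g -> homotopic g (push N 1 \o g).
Proof.
move=> lg; have gb : g (clamp 0) = base /\ g (clamp 1) = base.
  by rewrite (clamp_id unit0) (clamp_id unit1); exact: lg.2.2.
apply: (@homotopic_intro _ _ (fun q => push N (clamp q.2) (g (clamp q.1)))) => [|q|s Is|s Is|t].
- apply: (@push_continuous _ N (fun q : RR * RR => clamp q.2) (fun q => g (clamp q.1))).
  + move=> q; have c2 : snd @ q --> q.2 by exact: cvg_snd.
    exact: (cvg_comp _ _ c2 (@clamp_continuous q.2)).
  + by move=> q; exact: clampP.
  + move=> q; have c1 : fst @ q --> q.1 by exact: cvg_fst.
    exact: (cvg_comp _ _ c1 (loop_continuous lg (x := q.1))).
  + by move=> q; exact: loop_earring.
- exact/push_earring/loop_earring.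
- by rewrite /= (clamp_id unit0) push0 clamp_id.
- by rewrite /= (clamp_id unit1) (clamp_id Is).
- by rewrite /= gb.1 gb.2 push_tail //; exact: tail_base.
Qed.

(** * Splitting a loop between the first circles and the remaining ones *)

Section EarringHom.
Variables (T : Type) (G : group_on T) (phi : (RR -> pt) -> T).
Hypothesis phiH : hom_from_H G phi.

Lemma hom_eq g h : loop g -> loop h ->
  (forall s, unit_interval s -> g s = h s) -> phi g = phi h.
Proof.
move=> lg lh gh; apply: phiH.1 => //.
have gb : g (clamp 0) = base /\ g (clamp 1) = base.
  by rewrite (clamp_id unit0) (clamp_id unit1); exact: lg.2.2.
apply: (@homotopic_intro _ _ (fun q => g (clamp q.1))) => [q|q|s Is|s Is|t] //=.
- have c1 : fst @ q --> q.1 by exact: cvg_fst.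
  exact: (cvg_comp _ _ c1 (loop_continuous lg (x := q.1))).
- exact: loop_earring.
- by rewrite clamp_id.
- by rewrite (clamp_id Is) gh.
Qed.

Lemma hom_base g : loop g -> (forall s, unit_interval s -> g s = base) ->
  phi g = gone G.
Proof.
move=> lg gb; rewrite (hom_eq lg loop_cst gb); apply: gmul_idem.
rewrite -(phiH.2 _ _ loop_cst loop_cst); congr phi.
by apply/funext => s; rewrite /concat; case: ifP.
Qed.

Definition segment (g : RR -> pt) (a b : RR) : RR -> pt :=
  fun s => g (clamp (a + (b - a) * s)).

Lemma loop_segment g a b : loop g -> g (clamp a) = base -> g (clamp b) = base ->
  loop (segment g a b).
Proof.
move=> lg ga gb; apply: (loop_reparam lg (@affine_continuous a (b - a))).
  by rewrite mulr0 addr0.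
by rewrite mulr1 subrKC.
Qed.

Lemma hom_segment g a b c : loop g -> g (clamp a) = base ->
  g (clamp b) = base -> g (clamp c) = base ->
  phi (segment g a c) = gmul G (phi (segment g a b)) (phi (segment g b c)).
Proof.
move=> lg ga gb gc.
have lab := loop_segment lg ga gb; have lbc := loop_segment lg gb gc.
have lac := loop_segment lg ga gc.
rewrite -(phiH.2 _ _ lab lbc).
(* Along [eta] the loop [g] runs from [a] to [b] on the first half and from [b] to [c] on the
   second, which is the concatenation; the affine parameter from [a] to [c] has the same ends. *)
pose eta s := a + (b - a) * clamp (2 * s) + (c - b) * clamp (2 * s - 1).
have ce : continuous eta.
  move=> s.
  have c0 : (fun s : RR => 2 * s) @ s --> (2 * s : RR).
    by apply: cvgM; [exact: cvg_cst | exact: cvg_id].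
  have c1 : (fun s : RR => 2 * s - 1) @ s --> (2 * s - 1 : RR).
    by apply: (@cvgB _ RR^o) => //; exact: cvg_cst.
  have d0 := cvg_comp _ _ c0 (@clamp_continuous (2 * s)).
  have d1 := cvg_comp _ _ c1 (@clamp_continuous (2 * s - 1)).
  apply: (@cvgD _ RR^o); last by apply: cvgM => //; exact: cvg_cst.
  apply: (@cvgD _ RR^o); first exact: cvg_cst.
  by apply: cvgM => //; exact: cvg_cst.
have eta0 : eta 0 = a.
  by rewrite /eta mulr0 sub0r (clamp_id unit0) clamp_le0 ?mulr0 ?addr0 //; lra.
have eta1 : eta 1 = c.
  by rewrite /eta mulr1 !clamp_ge1 ?mulr1; lra.
have leta : loop (fun s => g (clamp (eta s))).
  by apply: loop_reparam => //; rewrite ?eta0 ?eta1.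
transitivity (phi (fun s => g (clamp (eta s)))).
  apply: phiH.1 => //; apply: homotopic_reparam => //.
  - exact: affine_continuous.
  - by rewrite mulr0 addr0.
  - by rewrite mulr1 subrKC.
  - by rewrite mulr0 addr0.
  - by rewrite mulr1 subrKC.
apply: hom_eq => //; first exact: loop_concat.
move=> s /andP[s0 s1]; rewrite /concat /segment /eta; case: leP => s2.
  rewrite (@clamp_id (2 * s)); last by rewrite /unit_interval /=; lra.
  by rewrite (@clamp_le0 (2 * s - 1)) ?mulr0 ?addr0 //; lra.
rewrite (@clamp_ge1 (2 * s)); last by lra.
rewrite (@clamp_id (2 * s - 1)); last by rewrite /unit_interval /=; lra.
by rewrite mulr1 subrKC.
Qed.

Variable N : nat.
Hypothesis phi_tail : forall g, loop g ->
  (forall s, unit_interval s -> tail_circles N (g s)) -> phi g = gone G.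

(** Induction on the number of pieces. If all pieces are of one kind, the retraction either fixes
    the segment or both values are trivial. Otherwise the segment is cut where the kind first
    changes, since [g] is at [base] there. *)
Lemma hom_retractN_partition g (t : nat -> RR) (M : nat) : loop g ->
  (forall l, unit_interval (t l)) -> (forall l, t l <= t l.+1) ->
  (forall l, (l < M)%N -> (forall s, t l <= s <= t l.+1 -> head_circles N (g s)) \/
                          (forall s, t l <= s <= t l.+1 -> tail_circles N (g s))) ->
  forall i j, (i <= j <= M)%N -> g (t i) = base -> g (t j) = base ->
  phi (segment g (t i) (t j)) = phi (segment (retractN N \o g) (t i) (t j)).
Proof.
move=> lg It tle ht i j; have lr := loop_retractN N lg.
have rb p : p = base -> retractN N p = base.
  by move->; exact/tail_retractN/tail_base.
have [n] := ubnP (j - i); elim: n => // n IH in i j *.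
rewrite ltnS => jin /andP[ij jM] gi gj.
have [lsi lri] : loop (segment g (t i) (t j)) /\
    loop (segment (retractN N \o g) (t i) (t j)).
  by split; apply: loop_segment => //=; rewrite clamp_id ?gi ?gj ?rb.
move: ij; rewrite leq_eqVlt => /orP[/eqP eij|ij].
  by rewrite !hom_base // => s _; rewrite /segment eij subrr mul0r addr0 /= clamp_id ?gj ?rb.
pose hd l := `[< forall s, t l <= s <= t l.+1 -> head_circles N (g s) >].
have hdT l s : hd l -> t l <= s <= t l.+1 -> head_circles N (g s) by move=> /asboolP; apply.
have hdF l s : (l < M)%N -> ~~ hd l -> t l <= s <= t l.+1 -> tail_circles N (g s).
  by move=> lM /asboolPn nh; have [//|] := ht l lM; apply.
have tmono l m : (l <= m)%N -> t l <= t m.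
  by move=> lm; exact: (homo_leq (@lexx _ _) (@le_trans _ _) tle).
have [[k /andP[ik kj] kE]|same] :=
    pselect (exists2 k, (i <= k < j)%N & hd k != hd i); last first.
  have sameE k : (i <= k < j)%N -> hd k = hd i.
    by move=> kij; apply/eqP; apply: contrapT => /negP h; apply: same; exists k.
  have piece s : unit_interval s -> exists2 k, (i <= k < j)%N &
      t k <= clamp (t i + (t j - t i) * s) <= t k.+1.
    move=> Is; have sb : t i <= clamp (t i + (t j - t i) * s) <= t j.
      have := tmono i j (ltnW ij); have /andP[i0 i1] := It i.
      have /andP[j0 j1] := It j; have /andP[s0 s1] := Is.
      move=> tij; rewrite clamp_id; first by apply/andP; split; nra.
      by rewrite /unit_interval /=; apply/andP; split; nra.
    move: (clamp _) sb => r; elim: (j) (ij) => // m IHm; rewrite ltnS leq_eqVlt.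
    case/orP => [/eqP <- /andP[ri rj]|im /andP[ri rj]].
      by exists i; rewrite ?leqnn ?ri.
    have [rm|rm] := leP r (t m).
      by have [|k km rk] := IHm im; [rewrite ri|exists k => //; lia].
    by exists m; [lia | rewrite (ltW rm)].
  have [hi|hi] := boolP (hd i).
    apply: hom_eq => // s /piece[k kij rk]; rewrite /segment /= head_retractN //.
    by apply: hdT rk; rewrite sameE.
  have gt s : unit_interval s -> tail_circles N (segment g (t i) (t j) s).
    by move=> /piece[k kij rk]; apply: hdF rk; [lia | rewrite sameE].
  rewrite phi_tail // hom_base // => s /gt ts.
  by rewrite /segment /= tail_retractN.
have ex : exists k, (i <= k < j)%N && (hd k != hd i) by exists k; rewrite ik kj.
case: (ex_minnP ex) => {k ik kj kE ex} k /andP[/andP[ik kj] kE] kmin.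
have ik' : (i < k)%N by rewrite ltn_neqAle ik andbT; apply: contraNneq kE => ->.
have kE' : hd k.-1 = hd i.
  apply/eqP; apply/negPn/negP => h; have := kmin k.-1; rewrite h andbT.
  by lia.
(* The point belongs to two adjacent pieces of different kinds, and head and tail circles meet only
   in [base]. *)
have gk : g (t k) = base.
  have tk1 : t k.-1 <= t k <= t k.-1.+1 by rewrite prednK ?tmono ?lexx //; lia.
  have tk : t k <= t k <= t k.+1 by rewrite lexx tle.
  move: kE; rewrite -kE'; have [h|h] := boolP (hd k); have [h'|h'] := boolP (hd k.-1) => // _.
    by apply: (@head_tail N); [exact: hdT tk | apply: hdF tk1 => //; lia].
  by apply: (@head_tail N); [exact: hdT tk1 | apply: hdF tk => //; lia].
have cb l : g (t l) = base -> g (clamp (t l)) = base by rewrite clamp_id.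
have rcb l : g (t l) = base -> (retractN N \o g) (clamp (t l)) = base.
  by move=> /cb /=; exact: rb.
rewrite (hom_segment lg (cb _ gi) (cb _ gk) (cb _ gj)).
rewrite (hom_segment lr (rcb _ gi) (rcb _ gk) (rcb _ gj)).
by rewrite (IH i k) ?(IH k j) //; lia.
Qed.

End EarringHom.

Lemma unit_compact : compact unit_interval.
Proof.
rewrite (_ : unit_interval = `[0, 1]%classic); first exact: segment_compact.
by apply/seteqP; split=> s /=; rewrite in_itv.
Qed.

(* Lebesgue number of the cover [{m < c}, {0 < m}] of the unit interval. *)
Lemma fine_partition (m : RR -> RR) (c : RR) : continuous m -> 0 < c ->
  exists2 M, (0 < M)%N & forall l, (l < M)%N ->
    (forall s, l%:R / M%:R <= s <= l.+1%:R / M%:R -> m s < c) \/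
    (forall s, l%:R / M%:R <= s <= l.+1%:R / M%:R -> 0 < m s).
Proof.
move=> cm c0.
pose P (i : nat) (x : RR) :=
  (forall s, x <= s <= x + i.+1%:R^-1 -> m s < c) \/
  (forall s, x <= s <= x + i.+1%:R^-1 -> 0 < m s).
have small (e : RR) : 0 < e -> \forall i \near \oo, i.+1%:R^-1 < e.
  by move=> e0; exact: near_infty_natSinv_lt (PosNum e0).
have loc (x : RR) (A : set RR) : nbhs x A ->
    \forall x' \near x & i \near \oo, forall s, x' <= s <= x' + i.+1%:R^-1 -> A s.
  move=> nA; have [e /= e0 eA] := (@nbhs_ballP RR RR^o x A).1 nA.
  have e2 : 0 < e / 2 by rewrite divr_gt0.
  exists (ball x (e / 2), [set i | (i.+1%:R^-1 : RR) < e / 2]).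
    by split=> /=; [exact: nbhsx_ballx | exact: small].
  move=> [x' i] /= [xx' ie] s /andP[]; move: ie; set d := _^-1 => ie s0 s1; apply: eA.
  move: xx'; rewrite /ball /= !ltr_norml => /andP[a b].
  apply/andP; split; lra.
(* Compactness makes one mesh [1 / (i+1)] work for all starting points. *)
have [i _ iP] : \forall i \near \oo, unit_interval `<=` P i.
  apply: ((compact_near_coveringP _).1 unit_compact) => x _.
  have [mx|mx] := ltP (m x) c.
    have : nbhs x [set s | m s < c] by exact: (cm x _ (lt_nbhsl mx)).
    by move=> /loc; apply: filterS => q qP; left.
  have : nbhs x [set s | 0 < m s] by exact: (cm x _ (lt_nbhsr (lt_le_trans c0 mx))).
  by move=> /loc; apply: filterS => q qP; right.
exists i.+1 => // l li; have a0 : (0 : RR) < i.+1%:R by [].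
have Il : unit_interval (l%:R / i.+1%:R).
  rewrite /unit_interval /= divr_ge0 ?ler0n //= ler_pdivrMr // mul1r ler_nat.
  exact: ltnW.
have -> : (l.+1%:R : RR) / i.+1%:R = l%:R / i.+1%:R + i.+1%:R^-1.
  by rewrite -natr1 mulrDl mul1r.
exact: (iP i (leqnn i) _ Il).
Qed.

(* After [push], the loop meets the two halves of the earring only in [base],
   so it splits into finitely many loops lying in one half each. *)
Lemma hom_retractN T (G : group_on T) (phi : (RR -> pt) -> T) N g :
  hom_from_H G phi -> (0 < N)%N ->
  (forall h, loop h -> (forall s, unit_interval s -> tail_circles N (h s)) -> phi h = gone G) ->
  loop g -> phi g = phi (retractN N \o g).
Proof.
move=> phiH N0 phi_tail lg.
have lr := loop_retractN N lg; have lp := loop_push N lg.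
have lpr := loop_push N lr.
rewrite (phiH.1 _ _ lg lp (homotopic_push N lg)).
rewrite (phiH.1 _ _ lr lpr (homotopic_push N lr)).
have lrp := loop_retractN N lp.
(* The collapse commutes with the retraction along [g], so only the pushed loop remains to be
   compared with its retraction. *)
transitivity (phi (retractN N \o (push N 1 \o g))); last first.
  apply: (hom_eq phiH) => // s Is /=.
  have [h|h] := earring_cover N (lg.2.1 s Is).
    by rewrite (head_retractN h) head_retractN //; exact: push_head.
  rewrite (push_tail _ h) (tail_retractN h) push_tail //; exact: tail_base.
(* The squared norm of the head part of [g]. Where it is below [1 / N^2], the push sends head points
   to [base], so the pushed loop is in the tail; where it is positive, [g] is in the head and stays
   there. *)
pose m s := sqn (retractN N (g (clamp s))).
have cm : continuous m.
  move=> s; apply: (@sqn_cvg _ (fun s => retractN N (g (clamp s)))).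
  exact: (retractN_continuous (N := N) (loop_continuous lg) (fun s => loop_earring s lg)).
have c0 : 0 < (N%:R ^+ 2)^-1 :> RR by rewrite invr_gt0 exprn_gt0 // ltr0n.
have [M M0 MP] := fine_partition cm c0.
have a0 : (0 : RR) < M%:R by rewrite ltr0n.
pose t l : RR := clamp (l%:R / M%:R).
have tE l : (l <= M)%N -> t l = l%:R / M%:R.
  move=> lM; apply: clamp_id; rewrite /unit_interval /= divr_ge0 ?ler0n //=.
  by rewrite ler_pdivrMr // mul1r ler_nat.
have t0 : t 0%N = 0 by rewrite tE // mul0r.
have t1 : t M = 1 by rewrite tE // divff // gt_eqF.
have tle l : t l <= t l.+1.
  by apply: le_clamp; rewrite ler_pM2r ?invr_gt0 // ler_nat.
have := @hom_retractN_partition _ _ _ phiH N phi_tail _ t M lp.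
move=> /(_ (fun l => clampP _) tle _ 0%N M); rewrite t0 t1 leq0n leqnn.
have segE h : loop h -> phi (segment h 0 1) = phi h.
  move=> lh; apply: (hom_eq phiH) => //.
    by apply: loop_segment; rewrite // clamp_id ?lh.2.2.1 ?lh.2.2.2 //;
      [exact: unit0|exact: unit1].
  by move=> s Is; rewrite /segment add0r subr0 mul1r clamp_id.
rewrite !segE //; apply => //; [|exact: lp.2.2.1|exact: lp.2.2.2].
move=> l lM; rewrite (tE l (ltnW lM)) (tE l.+1 lM).
have Is s : l%:R / M%:R <= s <= l.+1%:R / M%:R -> unit_interval s.
  rewrite -(tE l (ltnW lM)) -(tE l.+1 lM) => /andP[ls sl].
  have /andP[l0 _] := clampP (l%:R / M%:R); have /andP[_ l1] := clampP (l.+1%:R / M%:R).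
  by rewrite /unit_interval /= (le_trans l0 ls) (le_trans sl l1).
have [h|h] := MP l lM; [right|left] => s ls; have := h s ls;
  rewrite /m (clamp_id (Is s ls)) /=; have [gh|gt] := earring_cover N (lg.2.1 s (Is s ls)).
- rewrite head_retractN // => mc; rewrite push1_near_base //; first exact: tail_base.
  by rewrite mulrC -ler_pdivlMr ?exprn_gt0 ?ltr0n // mul1r ltW.
- by move=> _; rewrite push_tail.
- by move=> _; exact: push_head.
- by rewrite tail_retractN // /sqn /= expr0n /= addr0 ltxx.
Qed.

(** * Completeness of the set of loops under tail-closeness *)

Lemma tail_all p : (forall N, tail_circles N p) -> p = base.
Proof.
by move=> tp; have [n _ np] := tp 0%N; apply: (@head_tail n.+1) => //; exists n.
Qed.

Lemma tail_le M N p : (M <= N)%N -> tail_circles N p -> tail_circles M p.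
Proof. by move=> MN [n Nn np]; exists n => //; exact: leq_trans Nn. Qed.

(* Tail-closeness: a uniform structure on loops finer than uniform convergence
   in which concatenation is obviously continuous. *)
Definition close (M : nat) (g h : RR -> pt) := forall s, unit_interval s ->
  g s = h s \/ (tail_circles M (g s) /\ tail_circles M (h s)).

Lemma close_refl M g : close M g g. Proof. by move=> s _; left. Qed.

Lemma close_sym M g h : close M g h -> close M h g.
Proof. by move=> gh s /gh[->|[]]; [left|right]. Qed.

Lemma close_trans M g h k : close M g h -> close M h k -> close M g k.
Proof.
move=> gh hk s Is; have [->|[tg th]] := gh s Is; first exact: hk.
by have [<-|[_ tk]] := hk s Is; right.
Qed.

Lemma close_le M N g h : (M <= N)%N -> close N g h -> close M g h.
Proof.
by move=> MN gh s /gh[->|[tg th]]; [left|right; split; exact: tail_le MN _].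
Qed.

Lemma close_concat M g g' h h' : close M g g' -> close M h h' ->
  close M (concat g h) (concat g' h').
Proof.
move=> gg hh s /andP[s0 s1]; rewrite /concat; case: leP => s2.
  by apply: gg; rewrite /unit_interval /=; lra.
by apply: hh; rewrite /unit_interval /=; lra.
Qed.

Lemma continuous_uniform_limit (u : RR -> RR) :
  (forall e : RR, 0 < e -> exists2 v : RR -> RR, continuous v & forall s, `|u s - v s| <= e) ->
  continuous u.
Proof.
move=> uv s; apply: (@cvgrPdist_lt _ RR^o _ _ _ u _).2 => e e0.
have e4 : 0 < e / 4 by rewrite divr_gt0.
have [v cv vP] := uv _ e4.
have nv := (@cvgrPdist_lt _ RR^o _ _ (nbhs_filter s) v _).1 (cv s) _ e4.
apply: (@filterS _ (nbhs s) _ _ _ _ nv) => r /= vr.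
have := vP s; have := vP r; move: vr.
rewrite !ltr_norml !ler_norml => /andP[? ?] /andP[? ?] /andP[? ?].
by apply/andP; split; lra.
Qed.

(** Tail circles have small diameter, so closeness to continuous loops for arbitrarily large [M]
    makes both coordinates uniform limits. *)
Lemma close_continuous (l : RR -> pt) :
  (forall n, exists2 g, loop g & exists2 M, (n <= M)%N & close M g l) ->
  continuous (l \o clamp).
Proof.
move=> lP s.
have coord (f : pt -> RR) : (forall p, f p ^+ 2 <= sqn p) ->
    (forall g, loop g -> continuous (f \o (g \o clamp))) ->
    continuous (f \o (l \o clamp)).
  move=> fs cf; apply: continuous_uniform_limit => e e0.
  (* With [1 / (n+1) < e / 4], tail points have norm at most [e / 2], and two of them differ by at
     most [e] in each coordinate. *)
  have [n _ /(_ n (leqnn n)) ne] := near_infty_natSinv_lt (PosNum (divr_gt0 e0 (ltr0n RR 4))).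
  have [g lg [M nM gl]] := lP n; exists (f \o (g \o clamp)); first exact: cf.
  move=> r /=; have [->|[tg tl]] := gl _ (clampP r); first by rewrite subrr normr0 ltW.
  have bnd p : tail_circles M p -> `|f p| <= e / 2.
    move=> /tail_sqn pM; have nM' : (n.+1%:R : RR) <= M.+1%:R by rewrite ler_nat.
    have n0 : (0 : RR) < n.+1%:R by [].
    have ne' : 4 <= e * M.+1%:R.
      have : 4 <= e * n.+1%:R.
        move: ne => /=; rewrite -[X in X < _]div1r ltr_pdivrMr // => ?; lra.
      by move/le_trans; apply; rewrite ler_pM2l.
    have e2 : 0 <= e / 2 by rewrite divr_ge0 // ltW.
    rewrite -(@ler_pXn2r _ 2) ?nnegrE // real_normK ?num_real //.
    apply: le_trans (fs p) _.
    have M0 : (0 : RR) < M.+1%:R ^+ 2 by rewrite exprn_gt0.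
    rewrite -(ler_pM2r M0); apply: le_trans pM _.
    rewrite -exprMn; have : 2 <= e / 2 * M.+1%:R by rewrite mulrAC ler_pdivlMr //; lra.
    by move: (e / 2 * _) => r2 h2; rewrite expr2; nra.
  apply: le_trans (ler_normB _ _) _.
  by have := bnd _ tg; have := bnd _ tl; lra.
apply: (@cvg_pt _ (l \o clamp)).
  apply: (coord fst) => [p|g lg r]; first by rewrite /sqn lerDl sqr_ge0.
  exact: (fst_cvg (loop_continuous lg (x := r))).
apply: (coord snd) => [p|g lg r]; first by rewrite /sqn lerDr sqr_ge0.
exact: (snd_cvg (loop_continuous lg (x := r))).
Qed.

(** The limit is taken pointwise. If the values at [s] never stabilise, then [v k s] lies in the
    tail of index [k] for every [k >= n], so [base] is the right value. *)
Lemma close_complete n (v : nat -> RR -> pt) : (forall k, loop (v k)) ->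
  (forall k, (n <= k)%N -> close k (v k) (v k.+1)) ->
  exists2 l, loop l & forall k, (n <= k)%N -> close k (v k) l.
Proof.
move=> lv cv.
have cvm k j : (n <= k)%N -> close k (v k) (v (k + j)%N).
  move=> nk; elim: j => [|j IH]; first by rewrite addn0; exact: close_refl.
  apply: close_trans IH _; rewrite addnS.
  by apply: close_le (cv _ _); [exact: leq_addr | lia].
have /choice[l lP] : forall s, exists p,
    (exists k0, forall m, (k0 <= m)%N -> v m s = p) \/
    (p = base /\ forall k, exists2 m, (k <= m)%N & v m s <> v k s).
  move=> s; have [[k kP]|nk] := pselect (exists k, forall m, (k <= m)%N -> v m s = v k s).
    by exists (v k s); left; exists k.
  exists base; right; split=> // k; apply: contrapT => h; apply: nk; exists k => m km.
  by apply: contrapT => mk; apply: h; exists m.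
have lv' s : l s = base \/ exists k, l s = v k s.
  by case: (lP s) => [[k kP]|[]]; [right; exists k; rewrite kP | left].
have vl k : (n <= k)%N -> close k (v k) l.
  move=> nk s Is; have [[k0 k0P]|[-> h]] := lP s.
    have := cvm k k0 nk s Is; rewrite (k0P (k + k0)%N) //; exact: leq_addl.
  have [m km vm] := h k; have := cvm k (m - k)%N nk s Is; rewrite subnKC //.
  by case=> [/esym//|[tk _]]; right; split=> //; exact: tail_base.
exists l => //; apply: (@loop_intro _ (l \o clamp)).
- apply: close_continuous => k; exists (v (maxn n k)) => //.
  by exists (maxn n k); [exact: leq_maxr | apply: vl; exact: leq_maxl].
- by move=> s Is /=; rewrite clamp_id.
- move=> s Is; have [->|[k ->]] := lv' s; first exact: earring_base.
  exact: (lv k).2.1.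
- by have [|[k ->]] := lv' 0 => //; exact: (lv k).2.2.1.
- by have [|[k ->]] := lv' 1 => //; exact: (lv k).2.2.2.
Qed.

Lemma admits_n_slender T (G : group_on T) :
  admits_limiting_sequence_pair G -> n_slender G.
Proof.
move=> limG phi phiH.
pose X := {g | loop g}.
pose nb (g : X) : set_system X :=
  [set A | exists M, forall h : X, close M (sval g) (sval h) -> A h].
pose op (g h : X) : X := exist _ _ (loop_concat (svalP g) (svalP h)).
pose e : X := exist _ _ loop_cst.
have nbF g : Filter (nb g).
  split; first by exists 0%N.
    move=> A B [M MA] [N NB]; exists (maxn M N) => h gh; split.
      by apply: MA; apply: close_le gh; exact: leq_maxl.
    by apply: NB; apply: close_le gh; exact: leq_maxr.
  by move=> A B AB [M MA]; exists M => h /MA/AB.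
have [M MP] : nb e [set g | phi (sval g) = gone G].
  apply: (@locally_trivial T G limG X nb nbF _ op e (phi \o sval) _ _ _ \oo _ _ _
    (fun k a b => close k (sval a) (sval b))).
  - by move=> g A [M]; apply; exact: close_refl.
  - move=> x y A [M MA].
    exists [set x' | close M (sval x) (sval x')], [set y' | close M (sval y) (sval y')].
    by split; [exists M | exists M | move=> x' y' xx yy; apply: MA; exact: close_concat].
  (* The constant loop is idempotent on the nose, not merely up to homotopy. *)
  - by apply: eq_exist; apply/funext => s; rewrite /concat; case: ifP.
  - by move=> x y; exact: phiH.2 (svalP x) (svalP y).
  - by move=> n; exists n.
  - move=> v a b va vb; apply: (hom_eq phiH (svalP a) (svalP b)) => s Is.
    have ab M : close M (sval a) (sval b).
      have aM : nb a [set x | close M (sval a) (sval x)] by exists M.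
      have bM : nb b [set x | close M (sval b) (sval x)] by exists M.
      have [k [/= ak bk]] := filter_ex (filterI (va _ aM) (vb _ bM)).
      exact: close_trans ak (close_sym bk).
    (* Two limits are close for every [M]; where they differed, both would lie in every tail and
       hence equal [base]. *)
    apply: contrapT => nab.
    have tab M : tail_circles M (sval a s) /\ tail_circles M (sval b s).
      by have [|] := ab M s Is.
    apply: nab; rewrite (tail_all (fun M => (tab M).1)).
    by rewrite (tail_all (fun M => (tab M).2)).
  - by move=> n a; exists n.
  - move=> n v _ vQ.
    have [l ll lP] := close_complete (v := sval \o v) (fun k => svalP (v k)) vQ.
    exists (exist _ l ll) => A [M MA]; exists (maxn n M) => // k /= nMk.
    apply: MA; apply: close_sym; apply: (@close_le M k); first by lia.
    by apply: lP; lia.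
(* The maximum with 1 secures a positive number of circles; a loop in the tail of index at least [M]
   is [M]-close to the constant loop. *)
exists (maxn M 1); split; first by rewrite leq_max orbT.
move=> g lg; apply: (hom_retractN phiH) => //; first by rewrite leq_max orbT.
move=> h lh th; apply: (MP (exist _ h lh)) => s Is; right => /=; split; first exact: tail_base.
by apply: tail_le (th s Is); exact: leq_maxl.
Qed.

Theorem theoremA (T : Type) (G : group_on T) :
  admits_limiting_sequence_pair G ->
  n_slender G /\ cm_slender G /\ lcH_slender G.
Proof.
move=> limG; split; first exact: admits_n_slender.
by split; [exact: admits_cm_slender | exact: admits_lcH_slender].
Qed.
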